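(* Let $q$ be a complex number with $0<|q|<1$, let $x$ be a complex number, let $n\ge1$ and $k\ge1$ be integers, let $l_1,\dots,l_k\ge1$ be integers, and let $z_1,\dots,z_k$ be complex numbers. (a) If $z_jq^i\ne1$ for all $1\le j\le k$ and $1\le i\le n$, then $$\sum_{\substack{n\ge i_1\ge\cdots\ge i_k\ge1\\ i_0=n}}\frac{(x;q)_{i_k}(z_kq;q)_{i_k}}{(q;q)_{i_k}}\prod_{1\le j\le k-1}\frac{(z_jq;q)_{i_j}}{(1-q^{i_j})(z_{j+1}q;q)_{i_j}}\prod_{1\le j\le k}\frac{q^{i_j}}{1-z_jq^{i_j}}\,h_{l_j-1}\!\left(\frac{q^{i_j}}{1-z_jq^{i_j}},\dots,\frac{q^{i_{j-1}}}{1-z_jq^{i_{j-1}}}\right)$$ $$=\frac{(z_1q;q)_n}{(q;q)_n}\sum_{i\ge1}\begin{bmatrix}n\\ i\end{bmatrix}\frac{(-1)^{i-1}q^{\binom i2+il_1}}{(1-z_1q^i)^{l_1}}\sum_{\substack{i\ge i_1\ge\cdots\ge i_{k-1}\ge1\\ i_0=i}}(1-x^{i_{k-1}})\prod_{1\le j\le k-1}\frac{q^{i_jl_{j+1}}}{(1-q^{i_j})(1-z_{j+1}q^{i_j})^{l_{j+1}}}.$$ (b) If $z_j\ne0$ and $z_j\ne q^i$ for all $1\le j\le k$ and $1\le i\le n$, then $$\sum_{\substack{n\ge i_1\ge\cdots\ge i_k\ge1\\ i_0=n}}\frac{(1-x^{i_k})z_k^{i_k}(z_k^{-1}q;q)_{i_k}}{(q;q)_{i_k}}\prod_{1\le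 j\le k-1}\frac{q^{i_j}z_j^{i_j}z_{j+1}^{-i_j}(z_j^{-1}q;q)_{i_j}}{(1-q^{i_j})(z_{j+1}^{-1}q;q)_{i_j}}\prod_{1\le j\le k}\frac{1}{z_j-q^{i_j}}\,h_{l_j-1}\!\left(\frac{1}{z_j-q^{i_j}},\dots,\frac{1}{z_j-q^{i_{j-1}}}\right)$$ $$=\frac{z_1^n(z_1^{-1}q;q)_n}{(q;q)_n}\sum_{i\ge1}\begin{bmatrix}n\\ i\end{bmatrix}\frac{(-1)^{i-1}q^{\binom{i+1}2-ni}}{(z_1-q^i)^{l_1}}\sum_{\substack{i\ge i_1\ge\cdots\ge i_{k-1}\ge1\\ i_0=i}}(x;q)_{i_{k-1}}\prod_{1\le j\le k-1}\frac{q^{i_j}}{(1-q^{i_j})(z_{j+1}-q^{i_j})^{l_{j+1}}}.$$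
   Context: Notation: $(x;q)_0=1$ and $(x;q)_n=\prod_{i=1}^{n}(1-xq^{i-1})$. The Gaussian binomial coefficient is $\begin{bmatrix}n\\ r\end{bmatrix}=\frac{[n][n-1]\cdots[n-r+1]}{[r][r-1]\cdots[1]}$ with $[n]=\frac{1-q^n}{1-q}$; it is $0$ for $r>n$, so sums over $i\ge1$ are finite. Multiple sums run over integer tuples satisfying the displayed chain of inequalities; the additional line $i_0=n$ (respectively $i_0=i$) fixes the meaning of $i_0$. Empty products equal $1$; when $k=1$ the inner sum on the right-hand side has the single term with $i_{k-1}=i_0=i$. $h_k(a_1,\dots,a_N)=\sum_{1\le s_1\le\cdots\le s_k\le N}a_{s_1}\cdots a_{s_k}$ is the $k$-th complete symmetric function, $h_0=1$. The list $\frac{q^{a}}{1-zq^{a}},\dots,\frac{q^{b}}{1-zq^{b}}$ (with $a\le b$) means the $b-a+1$ quantities $\frac{q^{s}}{1-zq^{s}}$, $s=a,a+1,\dots,b$; similarly for $\frac1{z-q^a},\dots,\frac1{z-q^b}$. *)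

(* Defs.v *)
From mathcomp Require Import all_boot all_order all_algebra.
From mathcomp Require Import complex reals.

Set Implicit Arguments.
Unset Strict Implicit.
Unset Printing Implicit Defensive.

Import Order.TTheory GRing.Theory Num.Theory.
Local Open Scope ring_scope.

Definition qpoch (F : fieldType) (x q : F) (n : nat) : F :=
  \prod_(1 <= i < n.+1) (1 - x * q ^+ i.-1).

Definition qint (F : fieldType) (q : F) (n : nat) : F := (1 - q ^+ n) / (1 - q).

(* For r > n the truncated differences n - j include 0, so that the numerator
   vanishes, as it does with integer differences. *)
Definition qbinom (F : fieldType) (q : F) (n r : nat) : F :=
  (\prod_(0 <= j < r) qint q (n - j)) / \prod_(1 <= j < r.+1) qint q j.

(* Hence sums of multiples of qbinom q n i over i >= 1 stop at i = n. *)
Lemma qbinom_small (F : fieldType) (q : F) (n r : nat) :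
  (n < r)%N -> qbinom q n r = 0.
Proof.
move=> ltnr; rewrite /qbinom big_mkord (bigD1 (Ordinal ltnr)) //=.
by rewrite subnn /qint expr0 subrr !mul0r.
Qed.

(* The weakly increasing lists of k positions in a index the monomials; values
   are counted with multiplicity. *)
Definition hsym (F : fieldType) (k : nat) (a : seq F) : F :=
  \sum_(s : k.-tuple 'I_(size a) | sorted leq [seq val u | u <- s])
    \prod_(u <- s) a`_u.

(* f a, f (a + 1), ..., f b *)
Definition flist (F : fieldType) (f : nat -> F) (a b : nat) : seq F :=
  [seq f s | s <- index_iota a b.+1].

(* The entries of t are i_1, ..., i_m (values in 0..n), and
   chain_idx t 0 = i_0 = n, chain_idx t j = i_j for 1 <= j <= m. *)
Definition chain_idx (n m : nat) (t : m.-tuple 'I_n.+1) (j : nat) : nat :=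
  nth 0%N (n :: [seq val u | u <- t]) j.

(* n >= i_1 >= ... >= i_m >= 1 *)
Definition is_chain (n m : nat) (t : m.-tuple 'I_n.+1) : bool :=
  [forall j : 'I_m, (1 <= chain_idx t j.+1 <= chain_idx t j)%N].

(* Main.v *)
Require Import Defs.
From mathcomp Require Import all_boot all_order all_algebra.
From mathcomp Require Import complex reals.
From mathcomp Require Import ring.

Set Implicit Arguments.
Unset Strict Implicit.
Unset Printing Implicit Defensive.

Import Order.TTheory GRing.Theory Num.Theory.
Local Open Scope ring_scope.

(** Both sides are one word in a few linear operators on sequences indexed by
    the positive integers, and the identity is obtained by moving one operator,
    the q-binomial transform, through that word.

    Fix a base p, which is q in part (a) and 1/q in part (b).  Write
    a_z(i) = eps p^i / (1 - z p^i), D_z(i) = (zp;p)_i / (p;p)_i and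
    u(i) = eps / (1 - p^i), with eps = 1 for (a) and eps = -1 for (b); with
    these signs 1 / (z - q^i) is a_z(i) and q^i / (1 - q^i) is u(i) in base
    1/q.  Let S_a f (n) be the sum of a(s) f(s) over 1 <= s <= n, and let
      T f (n) = - sum_(i >= 1) K(n,i) f(i),
      K(n,i) = prod_(j < i) (p^n - p^j) / (1 - p^(j+1)).
    The kernel K(n,i) is the signed Gaussian binomial coefficient
    (-1)^i p^binom(i,2) [n,i]; in base 1/q it equals
    (-1)^i q^(binom(i+1,2) - ni) [n,i] with [n,i] in base q, so T is the
    transform on the right-hand side of each part ([kernelE], [kernelVE]).

    A complete symmetric function of a(i), ..., a(n) is a sum over weakly
    increasing indices, so that a(i) h_(l-1)(a(i), ..., a(n)) f(i), summed over
    i <= n, is S_a^l f (n) ([iter_cumul]).  The left-hand side is therefore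
    S^(l_1) D_(z_1) u D_(z_2)^-1 S^(l_2) D_(z_2) u ... S^(l_k) D_(z_k) b at n,
    with S taken at z_1, ..., z_k in turn, while the right-hand side is
    D_(z_1) T a^(l_1) S_u a^(l_2) ... S_u a^(l_k) c.
    The first word turns into the second by three rules:
    - S_(a_z) D_z T = D_z T a_z ([cumul_qtrans]);
    - u T = T S_u ([link_qtrans]);
    - b = T c, where b = (x;q)_i and c = 1 - x^i in part (a)
      ([qtrans_pow]), and the other way round in part (b) ([qtrans_qpoch]).
    The first two come from first-order recurrences of K in n and in i, the
    third from the two forms of the q-binomial theorem. *)

(** * Chain sums and complete symmetric functions as iterated sums *)
Section Sums.
Variable F : fieldType.

Lemma sum_path_cons N m (r : rel nat) b (G : seq nat -> F) :
  \sum_(t : m.+1.-tuple 'I_N | path r b [seq val u | u <- t])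
     G [seq val u | u <- t]
  = \sum_(i < N | r b i)
     \sum_(t : m.-tuple 'I_N | path r i [seq val u | u <- t])
       G (val i :: [seq val u | u <- t]).
Proof.
rewrite pair_big_dep /=.
rewrite (reindex (fun c : 'I_N * m.-tuple 'I_N => [tuple of c.1 :: c.2])) //=.
exists (fun t => (thead t, [tuple of behead t])) => [[i t] _|t _] /=.
  by congr pair; apply/val_inj.
by rewrite -tuple_eta.
Qed.

Definition descent (a c : nat) : bool := (1 <= c <= a)%N.

Lemma is_chainE n m (t : m.-tuple 'I_n.+1) :
  is_chain t = path descent n [seq val u | u <- t].
Proof.
apply/forallP/(pathP 0%N) => [ch j|ch j]; last first.
  by apply: ch; rewrite size_map size_tuple.
by rewrite size_map size_tuple => ltj; have := ch (Ordinal ltj).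
Qed.

(** The common recursive form of both chain sums.  A weight sees the previous
    index as well as its own, because the symmetric functions depend on both;
    the weights of the inner sum are those of the outer one, shifted by one
    level. *)
Fixpoint nested_sum m (w : nat -> nat -> nat -> F) (g : nat -> F) n : F :=
  if m is m'.+1 then
    \sum_(1 <= i < n.+1) w 0%N n i * nested_sum m' (fun j => w j.+1) g i
  else g n.

(** The bound N of the index type is kept apart from the starting point b, so
    that the induction can lower b while the type stays fixed. *)
Lemma sum_path_nested N m (w : nat -> nat -> nat -> F) g b : (b < N)%N ->
  \sum_(t : m.-tuple 'I_N | path descent b [seq val u | u <- t])
    (let i_ := nth 0%N (b :: [seq val u | u <- t]) in
     g (i_ m) * \prod_(0 <= j < m) w j (i_ j) (i_ j.+1))
  = nested_sum m w g b.
Proof.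
elim: m w b => [|m IH] w b ltb.
  rewrite (big_pred1 [tuple]) /=; last by move=> t; rewrite tuple0 /= eqxx.
  by rewrite big_nil mulr1.
rewrite (sum_path_cons _ _ _ b (fun s =>
  (g (nth 0%N (b :: s) m.+1) *
   \prod_(0 <= j < m.+1) w j (nth 0%N (b :: s) j) (nth 0%N (b :: s) j.+1)))).
rewrite /= (big_nat_widen _ _ _ _ _ ltb) (big_nat_widenl _ 0) // big_mkord.
apply: eq_big => [i|i /andP[_ ltib]]; first by rewrite /descent ltnS andbC.
rewrite -IH // mulr_sumr; apply: eq_bigr => t _ /=.
by rewrite big_nat_recl //= mulrCA.
Qed.

Lemma sum_chain_nested n m (w : nat -> nat -> nat -> F) g :
  \sum_(t : m.-tuple 'I_n.+1 | is_chain t)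
    (let i_ := chain_idx t in
     g (i_ m) * \prod_(0 <= j < m) w j (i_ j) (i_ j.+1))
  = nested_sum m w g n.
Proof.
rewrite -(sum_path_nested m w g (ltnSn n)).
by apply: eq_bigl => t; rewrite is_chainE.
Qed.

Lemma sum_triangle n (G : nat -> nat -> F) :
  \sum_(1 <= s < n.+1) \sum_(1 <= i < s.+1) G s i
  = \sum_(1 <= i < n.+1) \sum_(i <= s < n.+1) G s i.
Proof.
elim: n => [|n IH]; first by rewrite !big_geq.
rewrite big_nat_recr //= IH [RHS]big_nat_recr //= big_nat1.
rewrite [X in _ + X = _]big_nat_recr //= addrA -big_split /=; congr (_ + _).
by apply: eq_big_nat => i /andP[_ lei]; rewrite [RHS]big_nat_recr // ltnW.
Qed.

(** h_k(f i, ..., f n), expanded along the smallest index of each monomial. *)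
Fixpoint hsym_range (f : nat -> F) k i n : F :=
  if k is k'.+1 then \sum_(i <= s < n.+1) f s * hsym_range f k' s n else 1.

(** Positions in the list are values shifted by i; a lower bound b on the
    positions makes the statement inductive. *)
Lemma hsym_flist (f : nat -> F) k i n : hsym k (flist f i n) = hsym_range f k i n.
Proof.
pose g u := f (u + i)%N.
have gen N b : N = (n.+1 - i)%N ->
    \sum_(t : k.-tuple 'I_N | path leq b [seq val u | u <- t])
      \prod_(u <- [seq val u | u <- t]) g u = hsym_range f k (b + i) n.
  move=> eN; elim: k b => [|k IH] b.
    rewrite (big_pred1 [tuple]) /=; last by move=> t; rewrite tuple0 /= eqxx.
    by rewrite big_nil.
  rewrite (sum_path_cons _ _ _ b (fun s => \prod_(u <- s) g u)) /= big_addn -eN.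
  rewrite big_geq_mkord; apply: eq_bigr => j _.
  rewrite -IH mulr_sumr; apply: eq_bigr => t _.
  by rewrite big_cons.
rewrite /hsym.
have szf : size (flist f i n) = (n.+1 - i)%N by rewrite size_map size_iota.
rewrite -[RHS](gen _ 0%N szf).
apply: eq_big => [t|t _]; first by case: [seq _ | _ <- _].
rewrite big_map; apply: eq_bigr => u _.
rewrite /flist (nth_map 0%N) ?size_iota -?szf ?ltn_ord // /g nth_iota -?szf //.
by rewrite addnC.
Qed.

Definition cumul (a h : nat -> F) n : F := \sum_(1 <= s < n.+1) a s * h s.

(** Unfolding l.+1 nested summations produces a weakly increasing sequence of
    indices whose smallest one carries h; the others contribute exactly a
    complete symmetric function. *)
Lemma iter_cumul (a h : nat -> F) l n :
  iter l.+1 (cumul a) h n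
  = \sum_(1 <= i < n.+1) a i * hsym_range a l i n * h i.
Proof.
elim: l h => [|l IH] h.
  by apply: eq_bigr => i _; rewrite mulr1.
rewrite iterSr IH; under eq_bigr do rewrite mulr_sumr.
rewrite sum_triangle; apply: eq_bigr => i _ /=.
rewrite mulr_sumr mulr_suml; apply: eq_bigr => s _; ring.
Qed.

Lemma eq_iter_cumul (a h h' : nat -> F) l n :
  (forall i, (1 <= i <= n)%N -> h i = h' i) -> (0 < l)%N ->
  iter l (cumul a) h n = iter l (cumul a) h' n.
Proof.
case: l => // l eqh _; rewrite !iter_cumul.
by apply: eq_big_nat => i lei; rewrite eqh.
Qed.

End Sums.

(** * The q-binomial transform *)
Section Kernel.
Variables (F : fieldType) (p : F).
Hypothesis p_neq0 : p != 0.
Hypothesis p_nonroot : forall i, 1 - p ^+ i.+1 != 0.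

(** The signed Gaussian binomial coefficient (-1)^i p^binom(i,2) [n,i].  In this
    form it vanishes for i > n by itself, and it has simple ratios in i and
    in n, in the base p as well as in its inverse. *)
Definition kernel n i : F :=
  \prod_(0 <= j < i) ((p ^+ n - p ^+ j) / (1 - p ^+ j.+1)).

Lemma kernelSr n i :
  (1 - p ^+ i.+1) * kernel n i.+1 = (p ^+ n - p ^+ i) * kernel n i.
Proof.
by rewrite {1}/kernel big_nat_recr //= -/(kernel n i) mulrC -mulrA divfK // mulrC.
Qed.

Lemma kernelSS n i :
  (1 - p ^+ i.+1) * kernel n.+1 i.+1 = (p ^+ n.+1 - 1) * p ^+ i * kernel n i.
Proof.
elim: i => [|i IH].
  by rewrite kernelSr /kernel !big_nil expr0 !mulr1.
rewrite kernelSr; apply: (mulfI (p_nonroot i)).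
rewrite mulrCA IH.
transitivity ((p ^+ n.+1 - 1) * p ^+ i.+1 * ((p ^+ n - p ^+ i) * kernel n i)).
  by rewrite !exprS; ring.
by rewrite -kernelSr; ring.
Qed.

Lemma kernel_small n i : (n < i)%N -> kernel n i = 0.
Proof.
move=> ltn; rewrite /kernel (bigD1_seq n) ?iota_uniq //= ?mem_index_iota //.
by rewrite subrr !mul0r.
Qed.

(** This is (1 - p^(n+1)) [n,i] = (1 - p^(n+1-i)) [n+1,i], multiplied by p^i so
    that no exponent is a truncated difference. *)
Lemma kernel_shift n i :
  p ^+ i * (1 - p ^+ n.+1) * kernel n i = (p ^+ i - p ^+ n.+1) * kernel n.+1 i.
Proof.
apply: oppr_inj; rewrite -[RHS]mulNr opprB -kernelSr kernelSS; ring.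
Qed.

(** The two q-Pascal rules; each serves one form of the q-binomial theorem. *)
Lemma kernel_pascal n i :
  kernel n.+1 i.+1 = kernel n i.+1 - p ^+ n * kernel n i.
Proof.
apply: (mulfI (p_nonroot i)).
rewrite mulrBr kernelSS kernelSr !exprS; ring.
Qed.

Lemma kernel_pascalV n i :
  kernel n.+1 i.+1 = p ^+ i.+1 * kernel n i.+1 - p ^+ i * kernel n i.
Proof.
apply: (mulfI (p_nonroot i)).
rewrite mulrBr [X in _ = X - _]mulrCA kernelSS kernelSr !exprS; ring.
Qed.

Variable N : nat.

(** The upper bound N is the same for all n, which lets the transforms at
    different n be combined termwise; the terms with i > n vanish. *)
Definition qtrans (f : nat -> F) n : F := - \sum_(1 <= i < N.+1) kernel n i * f i.

Lemma eq_qtrans (f g : nat -> F) n :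
  (forall i, (1 <= i <= N)%N -> f i = g i) -> qtrans f n = qtrans g n.
Proof.
by move=> eqfg; congr (- _); apply: eq_big_nat => i lei; rewrite eqfg.
Qed.

Lemma kernel_sum n (b : nat -> F) :
  \sum_(0 <= i < N.+1) kernel n i * b i = b 0%N - qtrans b n.
Proof. by rewrite big_ltn // /kernel big_nil mul1r opprK. Qed.

(** The q-binomial theorem, by induction on n: the first Pascal rule multiplies
    the sum by 1 - x p^n. *)
Lemma kernel_sum_pow n x : (n <= N)%N ->
  \sum_(0 <= i < N.+1) kernel n i * x ^+ i = qpoch x p n.
Proof.
elim: n => [_|n IH ltnN].
  rewrite big_ltn // big_nat big1 => [|i /andP[i_gt0 _]].
    by rewrite /kernel /qpoch !big_nil addr0 mulr1.
  by rewrite kernel_small // mul0r.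
have eS : qpoch x p n.+1 = (1 - x * p ^+ n) * qpoch x p n.
  by rewrite /qpoch big_nat_recr //= mulrC.
rewrite eS -IH ?(ltnW ltnN) // big_nat_recl //.
rewrite [in RHS]big_nat_recl // mulrDr mulrBl mul1r.
under eq_bigr do rewrite kernel_pascal mulrBl.
rewrite sumrB.
have : \sum_(0 <= i < N) p ^+ n * kernel n i * x ^+ i.+1
       = x * p ^+ n * \sum_(0 <= i < N.+1) kernel n i * x ^+ i.
  rewrite [in RHS]big_nat_recr //= kernel_small // mul0r addr0 mulr_sumr.
  by apply: eq_bigr => i _; rewrite exprS; ring.
move->; rewrite [X in _ * p ^+ n * X]big_nat_recl // /kernel !big_nil; ring.
Qed.

(** The inverse form of the q-binomial theorem.  With base 1/p in the shifted
    factorial, the second Pascal rule makes the sum for n.+1 telescope up to x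
    times the sum for n. *)
Lemma kernel_sum_qpoch n x : (n <= N)%N ->
  \sum_(0 <= i < N.+1) kernel n i * qpoch x p^-1 i = x ^+ n.
Proof.
elim: n => [_|n IH ltnN].
  rewrite big_ltn // big_nat big1 => [|i /andP[i_gt0 _]].
    by rewrite /kernel /qpoch !big_nil addr0 mulr1.
  by rewrite kernel_small // mul0r.
have bS i : qpoch x p^-1 i.+1 = (1 - x * p ^- i) * qpoch x p^-1 i.
  by rewrite /qpoch big_nat_recr //= exprVn mulrC.
pose G i := p ^+ i * kernel n i * qpoch x p^-1 i.
rewrite exprS -IH ?(ltnW ltnN) // mulr_sumr big_nat_recl //.
rewrite [in RHS]big_nat_recr //= (kernel_small ltnN) mul0r mulr0 addr0.
have -> : kernel n.+1 0 * qpoch x p^-1 0 = G 0%N.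
  by rewrite /G /kernel /qpoch !big_nil !mulr1.
transitivity (G 0%N + \sum_(0 <= i < N)
    ((G i.+1 - G i) + x * (kernel n i * qpoch x p^-1 i))).
  congr (_ + _); apply: eq_bigr => i _.
  rewrite kernel_pascalV /G bS exprS; field; exact: expf_neq0.
rewrite big_split /= telescope_sumr // /G (kernel_small ltnN); ring.
Qed.

Lemma qpoch1 n : (0 < n)%N -> qpoch 1 p n = 0.
Proof.
by case: n => // n _; rewrite /qpoch big_ltn // expr0 mulr1 subrr mul0r.
Qed.

(** The constant 1 is its own transform, since (1;p)_n = 0 for n > 0. *)
Lemma qtrans_pow n x : (1 <= n <= N)%N ->
  qtrans (fun i => 1 - x ^+ i) n = qpoch x p n.
Proof.
case/andP=> n_gt0 lenN.
have -> : qtrans (fun i => 1 - x ^+ i) n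
          = qtrans (fun i => 1 ^+ i) n - qtrans (fun i => x ^+ i) n.
  rewrite /qtrans -opprD -sumrB; congr (- _); apply: eq_bigr => i _.
  by rewrite expr1n; ring.
have := kernel_sum_pow 1 lenN; rewrite qpoch1 // kernel_sum => /subr0_eq <-.
by rewrite -(kernel_sum_pow x lenN) kernel_sum // !expr0.
Qed.

Lemma qtrans_qpoch n x : (1 <= n <= N)%N ->
  qtrans (qpoch x p^-1) n = 1 - x ^+ n.
Proof.
case/andP=> _ lenN.
have := kernel_sum_qpoch x lenN; rewrite kernel_sum // {1}/qpoch big_nil => <-.
ring.
Qed.

(** The sign eps lets the factors 1 / (z - q^i) and q^i / (1 - q^i) of part (b)
    be the weights of base 1/q, where both change sign. *)
Variable eps : F.
Definition qratio z i : F := \prod_(1 <= s < i.+1) ((1 - z * p ^+ s) / (1 - p ^+ s)).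
Definition weight z i : F := eps * p ^+ i / (1 - z * p ^+ i).
Definition link i : F := eps / (1 - p ^+ i).

Definition regular z := forall i, (1 <= i <= N)%N -> 1 - z * p ^+ i != 0.

Lemma qratioS z i :
  (1 - p ^+ i.+1) * qratio z i.+1 = (1 - z * p ^+ i.+1) * qratio z i.
Proof.
by rewrite {1}/qratio big_nat_recr //= -/(qratio z i) mulrC -mulrA divfK // mulrC.
Qed.

Lemma qratio_neq0 z i : regular z -> (i <= N)%N -> qratio z i != 0.
Proof.
move=> zreg; elim: i => [_|i IH ltiN]; first by rewrite /qratio big_nil oner_neq0.
rewrite /qratio big_nat_recr //= mulf_neq0 ?IH ?(ltnW ltiN) //.
by rewrite mulf_neq0 ?invr_neq0 ?zreg.
Qed.

(** The increment in n of the right-hand side is the last term on the left: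
    after division by the common factor this is, for each i, the identity
    p^i ((1 - z p^(n+1)) - (1 - p^(n+1-i))) = p^(n+1) (1 - z p^i). *)
Lemma cumul_qtrans z f n : regular z -> (n <= N)%N ->
  cumul (weight z) (fun i => qratio z i * qtrans f i) n
  = qratio z n * qtrans (fun i => weight z i * f i) n.
Proof.
move=> zreg; elim: n => [_|n IH ltnN].
  rewrite /cumul big_geq // /qtrans big_nat big1 ?oppr0 ?mulr0 // => i.
  by case/andP=> i_gt0 _; rewrite kernel_small // mul0r.
rewrite /cumul big_nat_recr //= -/(cumul _ _ _) IH ?(ltnW ltnN) //.
apply: (mulfI (p_nonroot n)).
rewrite mulrDr [X in _ = X]mulrA qratioS.
transitivity (qratio z n * ((1 - p ^+ n.+1) * qtrans (fun i => weight z i * f i) n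
   + eps * p ^+ n.+1 * qtrans f n.+1)).
  rewrite mulrDr; congr (_ + _); first ring.
  transitivity (weight z n.+1 * ((1 - p ^+ n.+1) * qratio z n.+1) * qtrans f n.+1); first ring.
  by rewrite qratioS /weight; field; exact: zreg.
rewrite [in RHS]mulrAC mulrC; congr (_ * _).
rewrite /qtrans !mulrN -opprD; congr (- _).
rewrite !mulr_sumr -big_split /=; apply: eq_big_nat => i lei.
have zi : 1 - z * p ^+ i != 0 by exact: zreg.
transitivity (eps / (1 - z * p ^+ i) * f i * ((p ^+ i * (1 - p ^+ n.+1) * kernel n i)
   + p ^+ n.+1 * (1 - z * p ^+ i) * kernel n.+1 i)).
  by rewrite /weight; field.
by rewrite kernel_shift /weight; field.
Qed.

Lemma iter_cumul_qtrans z f l n : regular z -> (n <= N)%N ->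
  iter l (cumul (weight z)) (fun i => qratio z i * qtrans f i) n
  = qratio z n * qtrans (fun i => weight z i ^+ l * f i) n.
Proof.
move=> zreg lenN; elim: l n lenN => [|l IH] n lenN.
  by rewrite /=; congr (_ * _); apply: eq_qtrans => i _; rewrite mul1r.
transitivity (cumul (weight z)
    (fun i => qratio z i * qtrans (fun i => weight z i ^+ l * f i) i) n).
  apply: eq_big_nat => i /andP[_ lei]; rewrite -IH //; exact: leq_trans lenN.
rewrite cumul_qtrans //; congr (_ * _); apply: eq_qtrans => i _.
by rewrite exprS mulrA.
Qed.

(** Telescoping, as (1 - p^n) K(n,i) is the difference of (1 - p^i) K(n,i) and
    the same quantity at i.+1. *)
Lemma kernel_tail n j : (n <= N)%N -> (1 <= j <= N)%N ->
  (1 - p ^+ n) * \sum_(j <= i < N.+1) kernel n i = (1 - p ^+ j) * kernel n j.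
Proof.
move=> lenN /andP[j_gt0 lejN].
rewrite mulr_sumr.
rewrite (@telescope_sumr_eq _ _ _ (fun i => - ((1 - p ^+ i) * kernel n i)))
  ?(leqW lejN) //.
  by rewrite kernel_small // mulr0 oppr0 opprK add0r.
move=> i _; rewrite kernelSr; ring.
Qed.

Lemma link_qtrans f n : (1 <= n <= N)%N ->
  link n * qtrans f n = qtrans (cumul link f) n.
Proof.
case/andP=> n_gt0 lenN.
have n1 : 1 - p ^+ n != 0 by case: n n_gt0 {lenN}.
apply: (mulfI n1); rewrite /qtrans !mulrN; congr (- _).
under [in RHS]eq_bigr do rewrite mulr_sumr.
rewrite sum_triangle mulrA [LHS]mulr_sumr [RHS]mulr_sumr.
apply: eq_big_nat => i lei.
rewrite -[X in _ = _ * X]mulr_suml [RHS]mulrA kernel_tail // /link; field.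
by case: i lei => // i _; rewrite n1 p_nonroot.
Qed.

(** The operator word with T at its right end becomes the word with T at its
    left end; each level uses the commutation of T with S_(a_z) conjugated by
    D_z, and then with the multiplication by u.  The factors D_z are attached
    to levels: the weight of a level divides by its own D_z at the previous
    index. *)
Lemma nested_sum_qtrans m (z : nat -> F) (l : nat -> nat)
    (alpha beta : nat -> F) n :
  (forall i, (1 <= i <= N)%N -> beta i = qtrans alpha i) ->
  (forall j, (j < m)%N -> regular (z j) /\ (0 < l j)%N) ->
  (1 <= n <= N)%N ->
  nested_sum m (fun j a i => link a / qratio (z j) a *
     (qratio (z j) i * (weight (z j) i * hsym_range (weight (z j)) (l j).-1 i a))) beta n
  = qtrans (nested_sum m (fun j a i => link i * weight (z j) i ^+ l j) alpha) n.
Proof.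
move=> ab; elim: m z l n => [|m IH] z l n zl len /=; first exact: ab.
have [z0 l0] := zl 0%N (ltn0Sn _).
have n_leN : (n <= N)%N by case/andP: len.
set NL := nested_sum m _ beta; set NR := nested_sum m _ alpha.
have NLE i : (1 <= i <= N)%N -> NL i = qtrans NR i.
  by apply: (IH (fun j => z j.+1) (fun j => l j.+1)) => j ltj; apply: (zl j.+1).
transitivity (link n / qratio (z 0%N) n *
   iter (l 0%N) (cumul (weight (z 0%N))) (fun i => qratio (z 0%N) i * NL i) n).
  rewrite -[in RHS](prednK l0) iter_cumul mulr_sumr; apply: eq_bigr => i _; ring.
rewrite (@eq_iter_cumul _ _ _ (fun i => qratio (z 0%N) i * qtrans NR i)) //; last first.
  by move=> i /andP[i0 ile]; rewrite NLE // i0 (leq_trans ile).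
rewrite iter_cumul_qtrans // mulrA divfK ?qratio_neq0 // link_qtrans //.
by apply: eq_qtrans => i _; apply: eq_bigr => s _; rewrite mulrA.
Qed.

(** Both parts of the theorem at once, for a base p and a pair of boundary
    sequences related by T.  Levels are numbered from 0 here. *)
Lemma chain_qtrans m (z : nat -> F) (l : nat -> nat) (alpha beta : nat -> F) :
  (forall i, (1 <= i <= N)%N -> beta i = qtrans alpha i) ->
  (forall j, (j <= m)%N -> regular (z j) /\ (0 < l j)%N) ->
  \sum_(t : m.+1.-tuple 'I_N.+1 | is_chain t)
    (let i_ := chain_idx t in
     beta (i_ m.+1) * qratio (z m) (i_ m.+1)
     * (\prod_(0 <= j < m)
          (link (i_ j.+1) * qratio (z j) (i_ j.+1) / qratio (z j.+1) (i_ j.+1)))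
     * (\prod_(0 <= j < m.+1)
          (weight (z j) (i_ j.+1)
           * hsym (l j).-1 (flist (weight (z j)) (i_ j.+1) (i_ j)))))
  = qratio (z 0%N) N
    * \sum_(1 <= i < N.+1)
        (- kernel N i * weight (z 0%N) i ^+ l 0%N
         * \sum_(t : m.-tuple 'I_i.+1 | is_chain t)
             (let i_ := chain_idx t in
              alpha (i_ m)
              * \prod_(0 <= j < m)
                  (link (i_ j.+1) * weight (z j.+1) (i_ j.+1) ^+ l j.+1))).
Proof.
move=> ab zl.
have [z0 l0] := zl 0%N (leq0n _).
(* Each D_z(i_j) / D_z'(i_j) is split between two levels: D_z(i_j) goes to
   the level of i_j, and 1 / D_z'(i_j) to the next level. *)
pose W j a i := (if j is 0%N then 1 else link a / qratio (z j) a) *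
   (qratio (z j) i * (weight (z j) i * hsym_range (weight (z j)) (l j).-1 i a)).
transitivity (nested_sum m.+1 W beta N).
  rewrite -sum_chain_nested; apply: eq_bigr => t _ /=.
  rewrite /W !big_split /=.
  under [X in _ * (_ * X) = _]eq_bigr do rewrite hsym_flist.
  rewrite [X in _ = _ * (X * _)]big_nat_recl // [X in _ = _ * (_ * (X * _))]big_nat_recr //=.
  by rewrite !big_split /=; ring.
rewrite /=.
transitivity (iter (l 0%N) (cumul (weight (z 0%N)))
  (fun i => qratio (z 0%N) i * nested_sum m (fun j => W j.+1) beta i) N).
  rewrite -[in RHS](prednK l0) iter_cumul; apply: eq_bigr => i _; rewrite /W; ring.
rewrite (@eq_iter_cumul _ _ _ (fun i => qratio (z 0%N) i *
  qtrans (nested_sum m (fun j a i => link i * weight (z j.+1) i ^+ l j.+1) alpha) i)) //; last first.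
  move=> i lei; congr (_ * _).
  by apply: (nested_sum_qtrans (z := fun j => z j.+1) (l := fun j => l j.+1)) => // j ltj;
    apply: zl.
rewrite iter_cumul_qtrans //; congr (_ * _).
rewrite /qtrans -sumrN; apply: eq_bigr => i _.
rewrite (sum_chain_nested i m (fun j _ s => link s * weight (z j.+1) s ^+ l j.+1) alpha); ring.
Qed.

End Kernel.

(** * The transform in the bases q and 1/q *)
Section Specialization.
Variables (F : fieldType) (q : F).
Hypothesis q_neq0 : q != 0.
Hypothesis q_nonroot : forall i, 1 - q ^+ i.+1 != 0.

Lemma qpochS (x : F) i : qpoch x q i.+1 = qpoch x q i * (1 - x * q ^+ i).
Proof. by rewrite /qpoch big_nat_recr. Qed.

Lemma qpoch_neq0 i : qpoch q q i != 0.
Proof.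
elim: i => [|i IH]; first by rewrite /qpoch big_nil oner_neq0.
by rewrite qpochS mulf_neq0 // -exprS.
Qed.

Lemma nonrootV i : 1 - q^-1 ^+ i.+1 != 0.
Proof.
apply: contra (q_nonroot i); rewrite exprVn !subr_eq0 => /eqP eq1.
by rewrite -[q ^+ _]invrK -eq1 invr1.
Qed.

Lemma qratioE z i : qratio q z i = qpoch (z * q) q i / qpoch q q i.
Proof.
elim: i => [|i IH]; first by rewrite /qratio /qpoch !big_nil divr1.
rewrite /qratio big_nat_recr //= -/(qratio q z i) IH !qpochS.
rewrite -(mulrA z) -!exprS; field.
by rewrite qpoch_neq0 q_nonroot.
Qed.

Lemma qratioVE z i : z != 0 ->
  qratio q^-1 z i = z ^+ i * qpoch (z^-1 * q) q i / qpoch q q i.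
Proof.
move=> z0; elim: i => [|i IH]; first by rewrite /qratio /qpoch !big_nil divr1 mulr1.
rewrite /qratio big_nat_recr //= -/(qratio q^-1 z i) IH !qpochS.
rewrite -(mulrA z^-1) -!exprS.
have := nonrootV i; rewrite exprVn => nV.
have nq : q ^+ i.+1 != 0 by rewrite expf_neq0.
have := q_nonroot i; have := qpoch_neq0 i.
rewrite (exprS z); move: nq nV; move: (q ^+ i.+1) => Q nq nV Qn0 Q1.
field.
rewrite z0 Qn0 Q1 nq.
by rewrite -opprB oppr_eq0.
Qed.

Lemma qbinomS n i :
  qbinom q n i.+1 = qbinom q n i * (1 - q ^+ (n - i)) / (1 - q ^+ i.+1).
Proof.
have q1 : 1 - q != 0 by have := q_nonroot 0; rewrite expr1.
rewrite {1}/qbinom big_nat_recr //= [X in _ / X]big_nat_recr //=.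
rewrite invfM mulrACA -/(qbinom q n i) -[RHS]mulrA /qint; congr (_ * _).
by field; rewrite q1 q_nonroot.
Qed.

Lemma kernelE n i : (i <= n)%N ->
  kernel q n i = qbinom q n i * ((-1) ^+ i * q ^+ 'C(i, 2)).
Proof.
elim: i => [_|i IH ltin].
  by rewrite /kernel /qbinom !big_nil expr0 divr1 !mulr1.
apply: (mulfI (q_nonroot i)); rewrite kernelSr // IH ?(ltnW ltin) // qbinomS.
rewrite binS bin1 !exprD (exprS (-1)) -{1}(subnK (ltnW ltin)) exprD.
by field; rewrite q_nonroot.
Qed.

(** Inverting the base turns [n,i] into q^(-i(n-i)) [n,i]. *)
Lemma kernelVE n i : (i <= n)%N ->
  kernel q^-1 n i
  = qbinom q n i * ((-1) ^+ i * q ^ ('C(i.+1, 2)%:Z - (n * i)%:Z)).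
Proof.
elim: i => [_|i IH ltin].
  by rewrite /kernel /qbinom !big_nil muln0 subrr expr0z divr1 !mulr1.
apply: (mulfI (nonrootV i)).
rewrite kernelSr ?IH ?(ltnW ltin) // ?qbinomS; last exact: nonrootV.
have -> : ('C(i.+2, 2)%:Z - (n * i.+1)%:Z)%R
    = ('C(i.+1, 2)%:Z - (n * i)%:Z) + i.+1%:Z - n%:Z.
  by rewrite binS bin1 mulnS !PoszD; ring.
move: ('C(i.+1, 2)%:Z - (n * i)%:Z)%R => e.
rewrite !expfzDr // -exprnN -!exprnP (exprS (-1)) !exprVn.
have qin : q ^+ (n - i) = q ^+ n / q ^+ i.
  by rewrite -{2}(subnK (ltnW ltin)) exprD mulfK // expf_neq0.
rewrite qin.
move: (qbinom q n i) (q ^ e) => B C.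
have := q_nonroot i; rewrite !exprS => q1.
field.
by rewrite q1 q_neq0 !expf_neq0.
Qed.

Lemma weightV z s : weight q^-1 (-1) z s = 1 / (z - q ^+ s).
Proof.
rewrite /weight exprVn mulN1r div1r mulNr -mulrN -invrN -invfM opprB.
by rewrite mulrBr mulr1 mulrCA divff ?mulr1 // expf_neq0.
Qed.

Lemma linkV i : link q^-1 (-1) i = q ^+ i / (1 - q ^+ i).
Proof.
rewrite /link exprVn mulN1r -invrN opprB.
have q0 : q ^+ i != 0 by rewrite expf_neq0.
rewrite -[X in X / _]invrK -invfM mulrBr mulr1 mulVf //.
Qed.

End Specialization.

(** * The two identities *)
Theorem propositionB (R : realType) (q x : R[i]) (n k : nat)
    (l : nat -> nat) (z : nat -> R[i])
    (hq : 0 < `|q| < 1) (hn : (1 <= n)%N) (hk : (1 <= k)%N)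
    (hl : forall j : nat, (1 <= j <= k)%N -> (1 <= l j)%N) :
  ((forall j i : nat, (1 <= j <= k)%N -> (1 <= i <= n)%N -> z j * q ^+ i != 1) ->
     \sum_(t : k.-tuple 'I_n.+1 | is_chain t)
        (let i_ := chain_idx t in
         qpoch x q (i_ k) * qpoch (z k * q) q (i_ k) / qpoch q q (i_ k)
         * (\prod_(1 <= j < k)
              (qpoch (z j * q) q (i_ j)
               / ((1 - q ^+ i_ j) * qpoch (z j.+1 * q) q (i_ j))))
         * (\prod_(1 <= j < k.+1)
              (q ^+ i_ j / (1 - z j * q ^+ i_ j)
               * hsym (l j).-1
                   (flist (fun s => q ^+ s / (1 - z j * q ^+ s))
                      (i_ j) (i_ j.-1)))))
     = qpoch (z 1%N * q) q n / qpoch q q n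
       * \sum_(1 <= i < n.+1)
           (qbinom q n i
            * ((-1) ^+ i.-1 * q ^+ ('C(i, 2) + i * l 1%N)
               / (1 - z 1%N * q ^+ i) ^+ l 1%N)
            * \sum_(t : (k.-1).-tuple 'I_i.+1 | is_chain t)
                (let i_ := chain_idx t in
                 (1 - x ^+ i_ k.-1)
                 * \prod_(1 <= j < k)
                     (q ^+ (i_ j * l j.+1)
                      / ((1 - q ^+ i_ j)
                         * (1 - z j.+1 * q ^+ i_ j) ^+ l j.+1)))))
  /\
  ((forall j : nat, (1 <= j <= k)%N -> z j != 0) ->
   (forall j i : nat, (1 <= j <= k)%N -> (1 <= i <= n)%N -> z j != q ^+ i) ->
     \sum_(t : k.-tuple 'I_n.+1 | is_chain t)
        (let i_ := chain_idx t in
         (1 - x ^+ i_ k) * z k ^+ i_ k * qpoch ((z k)^-1 * q) q (i_ k)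
           / qpoch q q (i_ k)
         * (\prod_(1 <= j < k)
              (q ^+ i_ j * z j ^+ i_ j * z j.+1 ^- i_ j
                 * qpoch ((z j)^-1 * q) q (i_ j)
               / ((1 - q ^+ i_ j) * qpoch ((z j.+1)^-1 * q) q (i_ j))))
         * (\prod_(1 <= j < k.+1)
              (1 / (z j - q ^+ i_ j)
               * hsym (l j).-1
                   (flist (fun s => 1 / (z j - q ^+ s)) (i_ j) (i_ j.-1)))))
     = z 1%N ^+ n * qpoch ((z 1%N)^-1 * q) q n / qpoch q q n
       * \sum_(1 <= i < n.+1)
           (qbinom q n i
            * ((-1) ^+ i.-1 * q ^ ('C(i.+1, 2)%:Z - (n * i)%:Z)
               / (z 1%N - q ^+ i) ^+ l 1%N)
            * \sum_(t : (k.-1).-tuple 'I_i.+1 | is_chain t)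
                (let i_ := chain_idx t in
                 qpoch x q (i_ k.-1)
                 * \prod_(1 <= j < k)
                     (q ^+ i_ j
                      / ((1 - q ^+ i_ j)
                         * (z j.+1 - q ^+ i_ j) ^+ l j.+1))))).
Proof.
have q_neq0 : q != 0 by rewrite -normr_gt0; case/andP: hq.
have q_nonroot i : 1 - q ^+ i.+1 != 0.
  rewrite subr_eq0; apply/eqP => /(congr1 Num.norm); rewrite normr1 normrX => q1.
  have /andP[_ lt1] := hq; have := exprn_ilt1 i.+1 (normr_ge0 q) lt1.
  by rewrite -q1 ltxx.
case: k hk hl => // m _ l_gt0.
split=> [z_reg|z_neq0 z_reg].
- have reg j : (j <= m)%N -> regular q n (z j.+1) /\ (0 < l j.+1)%N.
    move=> lejm; split; last exact: l_gt0.
    by move=> i lei; rewrite subr_eq0 eq_sym z_reg.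
  have weightE s w : weight q 1 w s = q ^+ s / (1 - w * q ^+ s) by rewrite /weight mul1r.
  apply: etrans (etrans (chain_qtrans q_nonroot 1 (z := fun j => z j.+1)
    (l := fun j => l j.+1) (alpha := fun i => 1 - x ^+ i)
    (beta := qpoch x q) _ reg) _).
  + apply: eq_bigr => t _ /=.
    rewrite !big_add1 /= qratioE // -!mulrA; congr (_ * (_ * (_ * (_ * _)))).
      apply: eq_bigr => j _.
      rewrite /link !qratioE // invf_div -!mulrA mulKf ?qpoch_neq0 //.
      rewrite invfM; ring.
    apply: eq_bigr => j _; rewrite weightE; congr (_ * hsym _ _).
    by apply: eq_map => s; rewrite weightE.
  + by move=> i lei; rewrite qtrans_pow.
  rewrite qratioE //; congr (_ * _); apply: eq_big_nat => -[|i] // /andP[_ ltin].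
  congr (_ * _).
    rewrite kernelE // weightE expr_div_n -exprM exprD (exprS (-1)) /=; ring.
  apply: eq_bigr => t _ /=; congr (_ * _); rewrite big_add1 /=.
  apply: eq_bigr => j _; rewrite /link weightE expr_div_n -exprM invfM; ring.
have nonrootV' := nonrootV q_nonroot.
have reg j : (j <= m)%N -> regular q^-1 n (z j.+1) /\ (0 < l j.+1)%N.
  move=> lejm; split; last exact: l_gt0.
  move=> i lei; rewrite exprVn subr_eq0 eq_sym.
  by rewrite (can2_eq (mulfVK _) (mulfK _)) ?expf_neq0 // mul1r z_reg.
apply: etrans (etrans (chain_qtrans nonrootV' (-1) (z := fun j => z j.+1)
  (l := fun j => l j.+1) (alpha := qpoch x q)
  (beta := fun i => 1 - x ^+ i) _ reg) _).
+ apply: eq_bigr => t _ /=.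
  rewrite !big_add1 /= qratioVE ?z_neq0 ?leqnn //.
  rewrite -!mulrA; congr (_ * (_ * (_ * (_ * (_ * _))))).
    rewrite big_nat [RHS]big_nat; apply: eq_bigr => j /andP[_ ltj].
    rewrite linkV // !qratioVE ?z_neq0 //; last exact: leqW.
    rewrite invf_div -!mulrA mulKf ?qpoch_neq0 // !invfM; ring.
  apply: eq_bigr => j _; rewrite weightV //; congr (_ * hsym _ _).
  by apply: eq_map => s; rewrite weightV.
+ by move=> i lei; rewrite -[q in qpoch x q]invrK qtrans_qpoch ?invr_neq0.
rewrite qratioVE ?z_neq0 //; congr (_ * _).
apply: eq_big_nat => -[|i] // /andP[_ ltin].
congr (_ * _).
  rewrite kernelVE // weightV // expr_div_n expr1n (exprS (-1)) /=; ring.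
apply: eq_bigr => t _ /=; congr (_ * _); rewrite big_add1 /=.
apply: eq_bigr => j _; rewrite linkV // weightV // expr_div_n expr1n invfM; ring.
Qed.
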